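(* Let $f=\mathcal{I}(F):U\to\mathbb{H}$ be a slice function with stem function $F:\mathcal{U}\to\mathbb{C}\otimes\mathbb{H}\cong\mathbb{C}^4$. If $F(\mathcal{U})\subset\Omega$ and $\mathcal{U}\cap\mathbb{R}=\emptyset$, then there exist $k^2$ slice functions $f_m:U\to\mathbb{H}$, $m=1,\dots,k^2$, such that $$(f_m)^{\star k}=f.$$
   Context: Here $k$ is a positive integer, $\mathbb{H}$ is the algebra of quaternions and $\mathbb{S}=\{I\in\mathbb{H}: I^2=-1\}$. For $z\in\mathbb{C}$, $I\in\mathbb{S}$ put $\pi(z,I)=\mathrm{Re}(z)+I\,\mathrm{Im}(z)$. Elements of the real tensor product algebra $\mathbb{C}\otimes\mathbb{H}$ are written $w=w_0+\sqrt{-1}\,w_1$, $w_0,w_1\in\mathbb{H}$, with product $(v_0+\sqrt{-1}v_1)(w_0+\sqrt{-1}w_1)=v_0w_0-v_1w_1+\sqrt{-1}(v_0w_1+v_1w_0)$; put $\overline{w}=w_0-\sqrt{-1}\,w_1$ and $\pi(w,I)=w_0+Iw_1$. $\mathbb{C}\otimes\mathbb{H}$ is identified with $\mathbb{C}^4$ through the basis $1\otimes1,1\otimes i,1\otimes j,1\otimes k$. Standing assumption: $\mathcal{U}\subset\mathbb{C}$ is a simply connected open domain such that $\overline{\mathcal{U}}=\mathcal{U}$ (invariance under complex conjugation), or the union of two simply connected open domains that are symmetric with respect to the real line. $U=\pi(\mathcal{U}\times\mathbb{S})$. A stem function is a map $F:\mathcal{U}\to\mathbb{C}\otimes\mathbb{H}$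 with $F(\overline z)=\overline{F(z)}$; it induces the slice function $f=\mathcal{I}(F):U\to\mathbb{H}$, $f(\pi(z,I))=\pi(F(z),I)$. The $\star$-product is $\mathcal{I}(F)\star\mathcal{I}(G)=\mathcal{I}(FG)$ (pointwise product in $\mathbb{C}\otimes\mathbb{H}$), and $g^{\star k}$ is the $k$-th power for $\star$. $$\Omega=\{(z_0,z_1,z_2,z_3)\in\mathbb{C}^4:\ z_1^2+z_2^2+z_3^2\ne0,\ z_0^2+z_1^2+z_2^2+z_3^2\neq0,\ z_0\neq0\}.$$ *)

(* Defs.v *)
From HB Require Import structures.
From mathcomp Require Import all_boot all_order all_algebra.
From mathcomp Require Import all_classical all_reals all_analysis.
From mathcomp Require Import complex.
From mathcomp Require Import ring lra.

Set Implicit Arguments.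
Unset Strict Implicit.
Unset Printing Implicit Defensive.

Import Order.TTheory GRing.Theory Num.Theory.
Import numFieldNormedType.Exports.

Local Open Scope classical_set_scope.
Local Open Scope ring_scope.
Local Open Scope complex_scope.

(* Quat a b c d is a + b i + c j + d k *)
Record quat (R : Type) : Type := Quat { q0 : R; q1 : R; q2 : R; q3 : R }.

Section QuatChoice.
Variable R : Type.
Definition quat_to_prod (q : quat R) := (q0 q, q1 q, q2 q, q3 q).
Definition prod_to_quat (p : R * R * R * R) :=
  let: (a, b, c, d) := p in Quat a b c d.
Lemma quat_to_prodK : cancel quat_to_prod prod_to_quat.
Proof. by case. Qed.
End QuatChoice.

HB.instance Definition _ (R : eqType) :=
  Equality.copy (quat R) (can_type (@quat_to_prodK R)).
HB.instance Definition _ (R : choiceType) :=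
  Choice.copy (quat R) (can_type (@quat_to_prodK R)).

Section QuatRing.
Variable R : comNzRingType.
Implicit Types p q r : quat R.

Definition quat_real (a : R) : quat R := Quat a 0 0 0.

Definition addq p q :=
  Quat (q0 p + q0 q) (q1 p + q1 q) (q2 p + q2 q) (q3 p + q3 q).
Definition oppq q := Quat (- q0 q) (- q1 q) (- q2 q) (- q3 q).
Definition mulq p q :=
  Quat (q0 p * q0 q - q1 p * q1 q - q2 p * q2 q - q3 p * q3 q)
       (q0 p * q1 q + q1 p * q0 q + q2 p * q3 q - q3 p * q2 q)
       (q0 p * q2 q - q1 p * q3 q + q2 p * q0 q + q3 p * q1 q)
       (q0 p * q3 q + q1 p * q2 q - q2 p * q1 q + q3 p * q0 q).

Fact addqA : associative addq.
Proof. by move=> [????] [????] [????]; rewrite /addq /=; congr Quat; ring. Qed.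
Fact addqC : commutative addq.
Proof. by move=> [????] [????]; rewrite /addq /=; congr Quat; ring. Qed.
Fact add0q : left_id (quat_real 0) addq.
Proof. by move=> [????]; rewrite /addq /=; congr Quat; ring. Qed.
Fact addNq : left_inverse (quat_real 0) oppq addq.
Proof. by move=> [????]; rewrite /addq /= /quat_real; congr Quat; ring. Qed.

HB.instance Definition _ :=
  GRing.isZmodule.Build (quat R) addqA addqC add0q addNq.

Fact mulqA : associative mulq.
Proof. by move=> [????] [????] [????]; rewrite /mulq /=; congr Quat; ring. Qed.
Fact mul1q : left_id (quat_real 1) mulq.
Proof. by move=> [????]; rewrite /mulq /=; congr Quat; ring. Qed.
Fact mulq1 : right_id (quat_real 1) mulq.
Proof. by move=> [????]; rewrite /mulq /=; congr Quat; ring. Qed.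
Fact mulqDl : left_distributive mulq addq.
Proof.
by move=> [????] [????] [????]; rewrite /mulq /addq /=; congr Quat; ring.
Qed.
Fact mulqDr : right_distributive mulq addq.
Proof.
by move=> [????] [????] [????]; rewrite /mulq /addq /=; congr Quat; ring.
Qed.
Fact oneq_neq0 : quat_real 1 != 0 :> quat R.
Proof. by apply/eqP => -[] /eqP; rewrite oner_eq0. Qed.

HB.instance Definition _ :=
  GRing.Zmodule_isNzRing.Build (quat R)
    mulqA mul1q mulq1 mulqDl mulqDr oneq_neq0.

End QuatRing.

(* Ctens w0 w1 is w0 + sqrt(-1) w1 in C (x) H *)
Record ctens (R : Type) : Type := Ctens { ct0 : quat R; ct1 : quat R }.

Section CtensChoice.
Variable R : Type.
Definition ctens_to_prod (w : ctens R) := (ct0 w, ct1 w).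
Definition prod_to_ctens (p : quat R * quat R) := Ctens p.1 p.2.
Lemma ctens_to_prodK : cancel ctens_to_prod prod_to_ctens.
Proof. by case. Qed.
End CtensChoice.

HB.instance Definition _ (R : eqType) :=
  Equality.copy (ctens R) (can_type (@ctens_to_prodK R)).
HB.instance Definition _ (R : choiceType) :=
  Choice.copy (ctens R) (can_type (@ctens_to_prodK R)).

Section CtensRing.
Variable R : comNzRingType.
Implicit Types v w : ctens R.

Definition addct v w := Ctens (ct0 v + ct0 w) (ct1 v + ct1 w).
Definition oppct w := Ctens (- ct0 w) (- ct1 w).
Definition mulct v w :=
  Ctens (ct0 v * ct0 w - ct1 v * ct1 w) (ct0 v * ct1 w + ct1 v * ct0 w).

Fact addctA : associative addct.
Proof. by move=> [??] [??] [??]; rewrite /addct /= !addrA. Qed.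
Fact addctC : commutative addct.
Proof. by move=> [a b] [c d]; rewrite /addct /= addrC [b + d]addrC. Qed.
Fact add0ct : left_id (Ctens 0 0) addct.
Proof. by move=> [??]; rewrite /addct /= !add0r. Qed.
Fact addNct : left_inverse (Ctens 0 0) oppct addct.
Proof. by move=> [??]; rewrite /addct /= !addNr. Qed.

HB.instance Definition _ :=
  GRing.isZmodule.Build (ctens R) addctA addctC add0ct addNct.

Fact mulctA : associative mulct.
Proof.
move=> [a b] [c d] [e f]; rewrite /mulct /=.
rewrite !(mulrDl, mulrDr, mulrBl, mulrBr, mulNr, mulrN, opprD) !mulrA -!addrA.
by congr Ctens; congr (_ + _); rewrite addrA [LHS]addrC.
Qed.
Fact mul1ct : left_id (Ctens 1 0) mulct.
Proof. by move=> [??]; rewrite /mulct /= !mul1r !mul0r subr0 addr0. Qed.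
Fact mulct1 : right_id (Ctens 1 0) mulct.
Proof. by move=> [??]; rewrite /mulct /= !mulr1 !mulr0 subr0 add0r. Qed.
Fact mulctDl : left_distributive mulct addct.
Proof.
move=> [a b] [c d] [e f]; rewrite /mulct /addct /= !mulrDl opprD.
by congr Ctens; rewrite addrACA.
Qed.
Fact mulctDr : right_distributive mulct addct.
Proof.
move=> [a b] [c d] [e f]; rewrite /mulct /addct /= !mulrDr opprD.
by congr Ctens; rewrite addrACA.
Qed.
Fact onect_neq0 : Ctens 1 0 != 0 :> ctens R.
Proof. by apply/eqP => -[] /eqP; rewrite oner_eq0. Qed.

HB.instance Definition _ :=
  GRing.Zmodule_isNzRing.Build (ctens R)
    mulctA mul1ct mulct1 mulctDl mulctDr onect_neq0.

Definition conjct w := Ctens (ct0 w) (- ct1 w).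

End CtensRing.

(* C (x) H = C^4 through the basis 1(x)1, 1(x)i, 1(x)j, 1(x)k *)
Definition ctens_coord (R : Type) (w : ctens R) :
    R[i] * R[i] * R[i] * R[i] :=
  (q0 (ct0 w) +i* q0 (ct1 w), q1 (ct0 w) +i* q1 (ct1 w),
   q2 (ct0 w) +i* q2 (ct1 w), q3 (ct0 w) +i* q3 (ct1 w)).

Section SimplyConnected.
Variable T : topologicalType.
Variable R : realType.

(* based null-homotopy, inside A, of every loop in A *)
Definition loops_contract (A : set T) : Prop :=
  forall gamma : R -> T,
    {within `[0, 1], continuous gamma} ->
    (forall t, t \in `[0, 1] -> A (gamma t)) ->
    gamma 0 = gamma 1 ->
  exists h : R * R -> T,
    [/\ {within `[0, 1] `*` `[0, 1], continuous h},
        forall s t, s \in `[0, 1] -> t \in `[0, 1] -> A (h (s, t)),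
        forall t, t \in `[0, 1] -> h (0, t) = gamma t,
        forall t, t \in `[0, 1] -> h (1, t) = gamma 0 &
        forall s, s \in `[0, 1] -> h (s, 0) = gamma 0 /\ h (s, 1) = gamma 0].

End SimplyConnected.

Section Slice.
Variable R : realType.
Local Notation C := R[i].
Local Notation H := (quat R).
Implicit Types (D : set C) (F G : C -> ctens R) (z : C) (I : H).

(* C^o is C with the topology of its modulus; an open connected subset of C is
   path connected, so simple connectedness amounts to contracting loops *)
Definition sc_domain (A : set C) : Prop :=
  [/\ A !=set0, open (A : set C^o), connected (A : set C^o) &
      loops_contract R (A : set C^o)].

Definition admissible D : Prop :=
  (sc_domain D /\ conjc @` D = D) \/
  (exists A B : set C,
    [/\ sc_domain A, sc_domain B, B = conjc @` A & D = A `|` B]).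

Definition imag_units : set H := [set I | I ^+ 2 = -1].

Definition pi_pt z I : H := quat_real (complex.Re z) + I * quat_real (complex.Im z).
Definition pi_ct (w : ctens R) I : H := ct0 w + I * ct1 w.

Definition circ D : set H := [set pi_pt z I | z in D & I in imag_units].

(* only the values of F on D matter *)
Definition stem D F : Prop := {in D, forall z, F z^* = conjct (F z)}.

(* I(F); the value at q does not depend on the chosen representation of q,
   see slice_ofE *)
Definition slice_of D F (q : circ D) : H :=
  let zI := xget (0, 0) [set zI : C * H |
    [/\ D zI.1, imag_units zI.2 & pi_pt zI.1 zI.2 = \val q]] in
  pi_ct (F zI.1) zI.2.

Lemma imag_unitsE I : imag_units I ->
  q0 I = 0 /\ q1 I ^+ 2 + q2 I ^+ 2 + q3 I ^+ 2 = 1.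
Proof.
case: I => a b c d; rewrite /imag_units /= expr2 => -[e0 e1 e2 e3] /=.
have a0 : a = 0.
  apply/eqP/negPn/negP => an0.
  have b0 : b = 0 by apply: (mulfI an0); lra.
  have c0 : c = 0 by apply: (mulfI an0); lra.
  have d0 : d = 0 by apply: (mulfI an0); lra.
  by subst; nra.
by split=> //; subst; nra.
Qed.

Lemma imag_unitsN I : imag_units I -> imag_units (- I).
Proof. by rewrite /imag_units /= sqrrN. Qed.

Lemma pi_pt_eq z z' I I' : imag_units I -> imag_units I' ->
  pi_pt z I = pi_pt z' I' ->
  [\/ z = z' /\ I = I', z = z' /\ complex.Im z = 0 | z' = z^* /\ I' = - I].
Proof.
case: z z' => x y [x' y']; case: I I' => a b c d [a' b' c' d'].
move=> /imag_unitsE /= [-> nI] /imag_unitsE /= [-> nI'].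
rewrite /pi_pt /= => -[/= e0 e1 e2 e3].
have {e0} -> : x' = x by lra.
have eb : b * y = b' * y' by lra.
have ec : c * y = c' * y' by lra.
have ed : d * y = d' * y' by lra.
have : y ^+ 2 = y' ^+ 2.
  transitivity ((b * y) ^+ 2 + (c * y) ^+ 2 + (d * y) ^+ 2).
    by rewrite !exprMn -!mulrDl nI mul1r.
  by rewrite eb ec ed !exprMn -!mulrDl nI' mul1r.
have [->|y0] := eqVneq y 0.
  rewrite expr0n /= => /esym/eqP; rewrite sqrf_eq0 => /eqP ->.
  by constructor 2.
move/eqP; rewrite eqf_sqr => /orP[] /eqP E.
- constructor 1; subst y'.
  by rewrite (mulIf y0 eb) (mulIf y0 ec) (mulIf y0 ed).
- have E' : y' = - y by rewrite E opprK.
  constructor 3; subst y'; split=> //.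
  have <- : - b = b' by apply: (mulIf y0); lra.
  have <- : - c = c' by apply: (mulIf y0); lra.
  have <- : - d = d' by apply: (mulIf y0); lra.
  by congr Quat; rewrite oppr0.
Qed.

Lemma conjct_fix (w : ctens R) : conjct w = w -> ct1 w = 0.
Proof.
case: w => w0 [a b c d] [] /=; rewrite /oppq => ea eb ec ed.
by congr Quat; lra.
Qed.

Lemma slice_ofE D F (q : circ D) z I : stem D F -> D z -> imag_units I ->
  \val q = pi_pt z I -> slice_of F q = pi_ct (F z) I.
Proof.
move=> sF Dz SI qE; rewrite /slice_of; case: xgetP => [[z' I'] _ /= []|]; last first.
  by move=> /(_ (z, I)) []; split.
rewrite qE => Dz' SI' /esym /(pi_pt_eq SI SI') [[<- <-]//|[<- y0]|[-> ->]].
- suff w0 : ct1 (F z) = 0 by rewrite /pi_ct w0 !mulr0.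
  apply: conjct_fix; rewrite -(sF z) ?inE//; congr F.
  by case: z y0 {sF Dz qE} => x y /= ->; rewrite oppr0.
- by rewrite (sF z) ?inE// /pi_ct /= mulrN mulNr opprK.
Qed.

Lemma stem_inj D F G : stem D F -> stem D G ->
  slice_of F = slice_of G :> (circ D -> H) -> {in D, F =1 G}.
Proof.
move=> sF sG FG z; rewrite inE => Dz.
pose I : H := Quat 0 1 0 0.
have SI : imag_units I.
  by rewrite /imag_units /= expr2 /I; congr Quat => /=; ring.
have key J : imag_units J -> pi_ct (F z) J = pi_ct (G z) J.
  move=> SJ; have Dq : circ D (pi_pt z J) by exists z => //; exists J.
  pose q : circ D := SigSub (mem_set Dq).
  have := congr1 (@^~ q) FG; have qE : \val q = pi_pt z J by [].
  by rewrite (slice_ofE sF Dz SJ qE) (slice_ofE sG Dz SJ qE).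
move: (key _ SI) (key _ (imag_unitsN SI)); rewrite /pi_ct /I.
case: (F z) (G z) => [[????] [????]] [[????] [????]].
move=> [/= ????] [/= ????].
by congr Ctens; congr Quat; lra.
Qed.

Definition is_slice D (f : circ D -> H) : Prop :=
  exists2 F, stem D F & f = slice_of F.

(* a stem function inducing f, or 0 if f is not slice; it is unique on D by
   stem_inj, whence I(F) * I(G) = I(F G), see star_slice_of *)
Definition stem_of D (f : circ D -> H) : C -> ctens R :=
  xget (fun=> 0) [set F | stem D F /\ f = slice_of F].

Definition star D (f g : circ D -> H) : circ D -> H :=
  slice_of (fun z => stem_of f z * stem_of g z).

Definition starpow D (f : circ D -> H) (n : nat) : circ D -> H :=
  iter n (star f) (fun=> 1).

Lemma eq_slice_of D F G : {in D, F =1 G} ->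
  slice_of F = slice_of G :> (circ D -> H).
Proof.
move=> FG; apply/funext => q; rewrite /slice_of.
case: xgetP => [[z I] _ /= [Dz _ _]|]; first by rewrite FG ?inE.
have : circ D (\val q) by apply/set_mem/valP.
by move=> [z Dz [I SI qE]] /(_ (z, I)) [].
Qed.

Lemma stemM D F G : stem D F -> stem D G -> stem D (fun z => F z * G z).
Proof.
move=> sF sG z Dz; rewrite sF// sG//.
case: (F z) (G z) => [a b] [c d]; congr Ctens => /=.
  by rewrite mulrNN.
by rewrite mulrN mulNr opprD.
Qed.

Lemma stem_ofE D F : stem D F -> {in D, stem_of (slice_of F : circ D -> H) =1 F}.
Proof.
move=> sF; rewrite /stem_of; case: xgetP => [G _ /= [sG FG]|/(_ F)]; last first.
  by case; split.
by apply: stem_inj.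
Qed.

Lemma star_slice_of D F G : stem D F -> stem D G ->
  star (slice_of F) (slice_of G) =
  slice_of (fun z => F z * G z) :> (circ D -> H).
Proof.
by move=> sF sG; apply: eq_slice_of => z Dz; rewrite !stem_ofE.
Qed.

Lemma starpow_slice_of D F n : stem D F ->
  starpow (slice_of F) n = slice_of (fun z => F z ^+ n) :> (circ D -> H).
Proof.
move=> sF.
suff [sFn ->] : stem D (fun z => F z ^+ n) /\
  starpow (slice_of F) n = slice_of (fun z => F z ^+ n) :> (circ D -> H) by [].
elim: n => [|n [sFn IH]].
  split; first by move=> z Dz /=; rewrite !expr0; congr Ctens; rewrite oppr0.
  by apply/funext => q; rewrite /starpow /slice_of /= !expr0 /pi_ct /= mulr0 addr0.
have -> : (fun z => F z ^+ n.+1) = (fun z => F z * F z ^+ n).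
  by apply/funext => z; rewrite exprS.
split; first exact: stemM.
by rewrite -star_slice_of// -IH.
Qed.

Definition Omega : set (C * C * C * C) :=
  [set z | let: (z0, z1, z2, z3) := z in
    [/\ z1 ^+ 2 + z2 ^+ 2 + z3 ^+ 2 != 0,
        z0 ^+ 2 + z1 ^+ 2 + z2 ^+ 2 + z3 ^+ 2 != 0 & z0 != 0]].

Definition real_line : set C := [set z | complex.Im z = 0].

End Slice.

(* Main.v *)
Require Import Defs.
From HB Require Import structures.
From mathcomp Require Import all_boot all_order all_algebra.
From mathcomp Require Import all_classical all_reals all_analysis.
From mathcomp Require Import complex.
From mathcomp Require Import separable cyclotomic ring.

Local Open Scope classical_set_scope.
Local Open Scope ring_scope.

Set Implicit Arguments.
Unset Strict Implicit.
Unset Printing Implicit Defensive.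

Import Order.TTheory GRing.Theory Num.Theory.

(** The star product multiplies stem functions pointwise, and a stem function is
    an arbitrary map compatible with conjugation, so the theorem reduces to
    extracting roots in the algebra C (x) H one point at a time, in a way that
    respects conjugation.

    Roots at a point.  The algebra C (x) H is the algebra of quaternions with
    complex coefficients.  If p = z0 + v has a vector part v with
    s^2 = z1^2 + z2^2 + z3^2 nonzero, then J = v / s satisfies J^2 = -1, and
    C + C J is a copy of C x C: its idempotents are (1 - iJ)/2 and (1 + iJ)/2, in
    which p has coordinates z0 + is and z0 - is.  The product of the two
    coordinates is z0^2 + s^2, so on Omega both are nonzero, each has exactly k
    complex k-th roots, and the k^2 pairs of roots are distinct k-th roots of p
    ([quat_nth_roots], [ctens_nth_roots]).

    Conjugation.  The domain misses the real line and is symmetric, so it is the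
    disjoint union of its parts in the upper and lower half-planes, which
    conjugation exchanges.  Roots may thus be chosen freely in the upper half-plane
    and transported to the lower one ([stem_conj_extension]); they remain roots
    because conjugation is a ring morphism of C (x) H.  The k^2 families differ
    at every point of the domain, and a stem function is determined by the slice
    function it induces, so the k^2 slice functions are distinct. *)

Lemma nth_roots (K : numClosedFieldType) (k : nat) (c : K) :
  (0 < k)%N -> c != 0 ->
  exists r : 'I_k -> K, injective r /\ forall i, r i ^+ k = c.
Proof.
move=> k0 c0.
have [s sE] := closed_field_poly_normal ('X^k - 1 : {poly K}).
move: sE; rewrite (monicP (monicXnsubC 1 k0)) scale1r => sE.
(* k is invertible in K, so 'X^k - 1 is separable *)
have us : uniq s.
  rewrite -separable_prod_XsubC -sE separable_Xn_sub_1 //.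
  by rewrite pnatr_eq0 -lt0n.
have ss : size s = k.
  have := size_prod_XsubC s id; rewrite -sE size_XnsubC //.
  by case.
have sk z : z \in s -> z ^+ k = 1.
  rewrite -root_prod_XsubC -sE /root !hornerE subr_eq0.
  by move/eqP.
have d0 : k.-root c != 0 by rewrite rootC_eq0.
exists (fun i => k.-root c * s`_i); split.
  move=> i j /(mulfI d0)/eqP; rewrite nth_uniq ?ss //.
  by move/eqP/val_inj.
by move=> i; rewrite exprMn rootCK // sk ?mulr1 // mem_nth // ss.
Qed.

(** The element a (1 - iJ)/2 + b (1 + iJ)/2 of the algebra C + C J, where J is
    the imaginary quaternion with coordinates n1, n2, n3; when J^2 = -1, these
    two factors are complementary orthogonal idempotents. *)
Definition spectral (K : numClosedFieldType) (n1 n2 n3 a b : K) : quat K :=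
  let t := 'i * ((b - a) / 2%:R) in
  Quat ((a + b) / 2%:R) (t * n1) (t * n2) (t * n3).

Section Spectral.
Variables (K : numClosedFieldType) (n1 n2 n3 : K).
Hypothesis n_unit : n1 ^+ 2 + n2 ^+ 2 + n3 ^+ 2 = 1.
Local Notation sp := (spectral n1 n2 n3).

Lemma spectral1 : sp 1 1 = 1.
Proof.
by rewrite /spectral subrr mul0r mulr0 !mul0r -[1 + 1]/(2%:R : K) divff ?pnatr_eq0.
Qed.

Lemma spectralM a b c d : sp a b * sp c d = sp (a * c) (b * d).
Proof.
have ii : 'i ^+ 2 = -1 :> K := sqrCi K.
have n3E : n3 ^+ 2 = 1 - n1 ^+ 2 - n2 ^+ 2 by rewrite -n_unit; ring.
by rewrite /spectral; congr Quat => /=; field: ii n3E.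
Qed.

Lemma spectralX a b k : sp a b ^+ k = sp (a ^+ k) (b ^+ k).
Proof.
elim: k => [|k IH]; first by rewrite !expr0 spectral1.
by rewrite !exprS IH spectralM.
Qed.

(** Since n1, n2, n3 may be zero separately, b - a is recovered as the inner
    product of the vector part with (n1, n2, n3). *)
Lemma spectral_inj a b c d : sp a b = sp c d -> a = c /\ b = d.
Proof.
have ii : 'i ^+ 2 = -1 :> K := sqrCi K.
move=> [e0 e1 e2 e3].
have eD : a + b = c + d.
  by apply: (mulIf _ e0); rewrite invr_eq0 pnatr_eq0.
have eB : b - a = d - c.
  transitivity (- (2%:R * 'i * ('i * ((b - a) / 2%:R) *
      (n1 ^+ 2 + n2 ^+ 2 + n3 ^+ 2)))).
    by rewrite n_unit; field: ii.
  rewrite !mulrDr !expr2 !(mulrA ('i * _)) e1 e2 e3.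
  transitivity (- (2%:R * 'i * ('i * ((d - c) / 2%:R) *
      (n1 ^+ 2 + n2 ^+ 2 + n3 ^+ 2)))).
    by field.
  by rewrite n_unit; field: ii.
have two0 : 2%:R != 0 :> K by rewrite pnatr_eq0.
split; apply: (mulfI two0).
  by transitivity ((a + b) - (b - a)); [ring | rewrite eD eB; ring].
by transitivity ((a + b) + (b - a)); [ring | rewrite eD eB; ring].
Qed.

End Spectral.

(** With s a square root of the norm of the vector part, the direction is that
    part divided by s, and the two eigenvalues are z0 + is and z0 - is. *)
Lemma spectral_decomposition (K : numClosedFieldType) (p : quat K) :
  q1 p ^+ 2 + q2 p ^+ 2 + q3 p ^+ 2 != 0 ->
  exists n1 n2 n3 a b : K,
  [/\ n1 ^+ 2 + n2 ^+ 2 + n3 ^+ 2 = 1, p = spectral n1 n2 n3 a b &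
      a * b = q0 p ^+ 2 + q1 p ^+ 2 + q2 p ^+ 2 + q3 p ^+ 2].
Proof.
case: p => z0 z1 z2 z3 /= v0.
have ii : 'i ^+ 2 = -1 :> K := sqrCi K.
pose s := sqrtC (z1 ^+ 2 + z2 ^+ 2 + z3 ^+ 2).
have sE : s ^+ 2 = z1 ^+ 2 + z2 ^+ 2 + z3 ^+ 2 by rewrite sqrtCK.
have s0 : s != 0 by rewrite sqrtC_eq0.
exists (z1 / s), (z2 / s), (z3 / s), (z0 + 'i * s), (z0 - 'i * s).
split.
- by rewrite !expr_div_n -!mulrDl -sE divff // expf_neq0.
- by rewrite /spectral; congr Quat; field: ii.
- by rewrite -!addrA [X in z0 ^+ 2 + X]addrA -sE; ring: ii.
Qed.

Lemma quat_nth_roots (K : numClosedFieldType) (k : nat) (p : quat K) :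
  (0 < k)%N ->
  q1 p ^+ 2 + q2 p ^+ 2 + q3 p ^+ 2 != 0 ->
  q0 p ^+ 2 + q1 p ^+ 2 + q2 p ^+ 2 + q3 p ^+ 2 != 0 ->
  exists r : 'I_(k ^ 2) -> quat K, injective r /\ forall m, r m ^+ k = p.
Proof.
move=> k0 v0.
have [n1 [n2 [n3 [a [b [n_unit -> <-]]]]]] := spectral_decomposition v0.
rewrite mulf_eq0 negb_or => /andP[a0 b0].
have [r [rI rE]] := @nth_roots K k a k0 a0.
have [t [tI tE]] := @nth_roots K k b k0 b0.
(* m in 'I_(k ^ 2) encodes the choice of one root for each eigenvalue *)
have e : (k ^ 2)%N = #|{: 'I_k * 'I_k}| by rewrite card_prod !card_ord mulnn.
pose ij m := enum_val (cast_ord e m).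
exists (fun m => spectral n1 n2 n3 (r (ij m).1) (t (ij m).2)); split.
  move=> m m' /(spectral_inj n_unit)[/rI e1 /tI e2].
  apply/(@cast_ord_inj _ _ e)/enum_val_inj.
  by rewrite -/(ij m) -/(ij m'); case: (ij m) (ij m') e1 e2 => [? ?] [? ?] /= -> ->.
by move=> m; rewrite spectralX // rE tE.
Qed.

(** Viewing C (x) H as the quaternions over R[i] makes its complex scalars
    available, so that the decomposition above applies. *)
Section Complexification.
Variable R : rcfType.

Definition ctens_of_quat (p : quat R[i]) : ctens R :=
  Ctens (Quat (complex.Re (q0 p)) (complex.Re (q1 p)) (complex.Re (q2 p)) (complex.Re (q3 p)))
          (Quat (complex.Im (q0 p)) (complex.Im (q1 p)) (complex.Im (q2 p)) (complex.Im (q3 p))).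

Definition quat_of_ctens (w : ctens R) : quat R[i] :=
  let: (z0, z1, z2, z3) := ctens_coord w in Quat z0 z1 z2 z3.

Lemma ctens_of_quatK : cancel ctens_of_quat quat_of_ctens.
Proof. by case=> [[? ?] [? ?] [? ?] [? ?]]. Qed.

Lemma quat_of_ctensK : cancel quat_of_ctens ctens_of_quat.
Proof. by case=> [[? ? ? ?] [? ? ? ?]]. Qed.

Fact ctens_of_quat_zmod_morphism : zmod_morphism ctens_of_quat.
Proof. by move=> [[? ?] [? ?] [? ?] [? ?]] [[? ?] [? ?] [? ?] [? ?]]. Qed.

Fact ctens_of_quat_monoid_morphism : monoid_morphism ctens_of_quat.
Proof.
split=> // -[[? ?] [? ?] [? ?] [? ?]] [[? ?] [? ?] [? ?] [? ?]].
by congr Ctens; congr Quat => /=; ring.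
Qed.

HB.instance Definition _ :=
  GRing.isZmodMorphism.Build _ _ ctens_of_quat ctens_of_quat_zmod_morphism.
HB.instance Definition _ :=
  GRing.isMonoidMorphism.Build _ _ ctens_of_quat ctens_of_quat_monoid_morphism.

End Complexification.

Section Conjugation.
Variable R : comNzRingType.

Fact conjct_zmod_morphism : zmod_morphism (@conjct R).
Proof. by move=> v w; apply: (congr2 (@Ctens R)) => //=; rewrite opprD. Qed.

Fact conjct_monoid_morphism : monoid_morphism (@conjct R).
Proof.
split=> [|v w]; apply: (congr2 (@Ctens R)) => //=.
- by rewrite oppr0.
- by rewrite mulrNN.
by rewrite mulrN mulNr opprD.
Qed.

HB.instance Definition _ :=
  GRing.isZmodMorphism.Build _ _ (@conjct R) conjct_zmod_morphism.
HB.instance Definition _ :=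
  GRing.isMonoidMorphism.Build _ _ (@conjct R) conjct_monoid_morphism.

Lemma conjctK : involutive (@conjct R).
Proof. by case=> v w; rewrite /conjct /= opprK. Qed.

End Conjugation.

Lemma ctens_nth_roots (R : realType) (k : nat) (w : ctens R) :
  (0 < k)%N -> Omega (ctens_coord w) ->
  exists r : 'I_(k ^ 2) -> ctens R, injective r /\ forall m, r m ^+ k = w.
Proof.
case: w => [[a b c d] [a' b' c' d']] k0 [v0 n0 _].
set w := Ctens _ _.
have [r [rI rE]] := @quat_nth_roots _ k (quat_of_ctens w) k0 v0 n0.
exists (fun m => ctens_of_quat (r m)); split.
  exact: inj_comp (can_inj (@ctens_of_quatK R)) rI.
move=> m; rewrite -rmorphXn rE; exact: quat_of_ctensK.
Qed.

Lemma admissible_conj (R : realType) (D : set R[i]) :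
  admissible D -> forall z, D z -> D (conjc z).
Proof.
move=> [[_ DE] z Dz|[A [B [_ _ -> ->]]] z [Az|[a Aa <-]]].
- by rewrite -DE; exists z.
- by right; exists z.
- by left; rewrite conjcK.
Qed.

Lemma admissible_nonempty (R : realType) (D : set R[i]) :
  admissible D -> D !=set0.
Proof.
move=> [[[]]//|[A [B [[[z Az] _ _ _] _ _ ->]]]].
by exists z; left.
Qed.

(** Only the values of r on the open upper half-plane are kept. *)
Definition conj_extension (R : realType) (r : R[i] -> ctens R) (z : R[i]) :=
  if 0 < complex.Im z then r z else conjct (r (conjc z)).

Lemma stem_conj_extension (R : realType) (D : set R[i]) (r : R[i] -> ctens R) :
  D `&` @real_line R = set0 -> stem D (conj_extension r).
Proof.
move=> DR z; rewrite inE => Dz.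
have y0 : complex.Im z != 0.
  by apply/eqP => y0; have : (D `&` @real_line R) z by []; rewrite DR.
rewrite /conj_extension conjcK.
have -> : complex.Im (conjc z) = - complex.Im z by case: z {Dz y0}.
by rewrite oppr_gt0; case: ltgtP y0 => // _ _; rewrite conjctK.
Qed.

Theorem theorem5p3 (R : realType) (k : nat) (hk : (0 < k)%N)
    (D : set R[i]) (hD : admissible D)
    (F : R[i] -> ctens R) (hF : stem D F)
    (f : circ D -> quat R) (hf : f = slice_of F)
    (hOmega : [set ctens_coord (F z) | z in D] `<=` Omega (R := R))
    (hreal : D `&` real_line (R := R) = set0) :
  exists fm : 'I_(k ^ 2) -> circ D -> quat R,
    [/\ injective fm,
        forall m, is_slice (fm m) &
        forall m, starpow (fm m) k = f].
Proof.
have /choice[r rP] : forall z, exists r : 'I_(k ^ 2) -> ctens R,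
    D z -> injective r /\ forall m, r m ^+ k = F z.
  move=> z; have [Dz|nDz] := pselect (D z); last by exists (fun=> 0).
  have [|r rP] := @ctens_nth_roots R k (F z) hk; last by exists r.
  by apply: hOmega; exists z.
pose G m := conj_extension (r^~ m).
have sG m : stem D (G m) by exact: stem_conj_extension.
have GX m : {in D, forall z, G m z ^+ k = F z}.
  move=> z Dz; rewrite /G /conj_extension; case: ifP => _.
    by apply: (rP z _).2; exact: set_mem.
  have Dz' : D (conjc z) by apply: admissible_conj => //; exact: set_mem.
  by rewrite -rmorphXn (rP _ Dz').2 /= -hF ?inE// conjcK.
exists (fun m => slice_of (G m)); split.
- move=> m m' GG; have [z Dz] := admissible_nonempty hD.
  have := stem_inj (sG m) (sG m') GG (mem_set Dz).
  rewrite /G /conj_extension; case: ifP => _; first exact: (rP z Dz).1.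
  by move/(can_inj (@conjctK R))/(rP _ (admissible_conj hD Dz)).1.
- by move=> m; exists (G m).
- by move=> m; rewrite starpow_slice_of // hf; apply: eq_slice_of; exact: GX.
Qed.
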